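(* Let $m,n \geq 1$ and $t \geq 2$ be integers, and let $v$ be a vertex of $H_{\infty,\infty}$. Then \[\gamma_{t,1}(H_{m,n}) \geq \left\lceil \frac{2m+n(4m+2)}{|V(P_v(t))|} \right\rceil.\]
   Context: The infinite truncated square tiling graph $H_{\infty,\infty}$ has vertex set $\{(a,(x,y)) : a\in\mathbb{Z}_4,\ (x,y)\in\mathbb{Z}^2\}$. Its edges are: $(a,(x,y))\sim(a+1,(x,y))$ with $a+1$ taken modulo 4 (so each $(x,y)$ carries a 4-cycle whose vertices $0,1,2,3$ are its top, right, bottom, left vertices); $(1,(x,y))\sim(3,(x+1,y))$; and $(0,(x,y))\sim(2,(x,y+1))$. For $(x,y)\in\mathbb{Z}^2$ the octagon $O_{x,y}$ is the 8-cycle through $(0,(x,y)),(1,(x,y)),(3,(x+1,y)),(0,(x+1,y)),(2,(x+1,y+1)),(3,(x+1,y+1)),(1,(x,y+1)),(2,(x,y+1))$, in this cyclic order. For positive integers $m,n$, $H_{m,n}$ is the finite subgraph consisting of $m$ rows of $n$ octagons each: the union of the octagons $O_{x,y}$ with $0\le x\le n-1$, $0\le y\le m-1$. $P_v(t)$ is the subgraph of $H_{\infty,\infty}$ consisting of all vertices within distance $t-1$ of $v$ (distance in $H_{\infty,\infty}$), so $V(P_v(t))=\{u : d(u,v)\le t-1\}$. For a graph $G$ and integers $1\le r\le t$, a set $T\subseteq V(G)$ is a $(t,r)$ broadcast (dominating set) of $G$ if every $u\in V(G)$ satisfies $\sum_{v\in T,\ d(u,v)<t}(t-d(u,v))\ge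 r$, where $d$ is the graph distance in $G$. For finite $G$, the $(t,r)$ broadcast domination number $\gamma_{t,r}(G)$ is the smallest cardinality of a $(t,r)$ broadcast of $G$. *)

(* Defs.v *)
From HB Require Import structures.
From mathcomp Require Import all_boot all_order all_algebra.
From mathcomp Require Import finmap.
From mathcomp Require Import boolp classical_sets functions cardinality.

Set Implicit Arguments.
Unset Strict Implicit.
Unset Printing Implicit Defensive.

Import GRing.Theory.

Local Open Scope ring_scope.

(** * Graphs, given by their adjacency relation *)

Definition walk (V : eqType) (e : rel V) (u v : V) (k : nat) : Prop :=
  exists p : seq V, [/\ path e u p, last u p = v & size p = k].

(* [None] is the infinite distance between distinct components. *)
Definition gdist (V : eqType) (e : rel V) (u v : V) : option nat :=
  if pselect (exists k, `[< walk e u v k >]) is left h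
  then Some (ex_minn h) else None.

Definition gball (V : eqType) (e : rel V) (v : V) (k : nat) : classical_sets.set V :=
  [set u | exists2 d, gdist e u v = Some d & (d <= k)%N]%classic.

Lemma finite_gball (V : choiceType) (e : rel V) (v : V) (k : nat) :
  (forall w, finite_set [set u | e u w]%classic) -> finite_set (gball e v k).
Proof.
move=> fin_e; have fin_w j : finite_set [set u | walk e u v j]%classic.
  elim: j => [|j IHj].
    apply: sub_finite_set (finite_set1 v) => u /= [p [_ <-]].
    by move/size0nil => ->.
  pose W := [set u | walk e u v j]%classic.
  apply: (@sub_finite_set _ _ (\bigcup_(w in W) [set u | e u w])%classic).
    move=> u /= [[|w p] [] //= /andP[euw wp] lp [sp]].
    by exists w => //; exists p.
  exact: bigcup_finite.
apply: (@sub_finite_set _ _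
  (\bigcup_(j in `I_k.+1) [set u | walk e u v j])%classic).
  move=> u [d]; rewrite /gdist; case: pselect => // h [<-] lek.
  by exists (ex_minn h) => //=; case: ex_minnP => ? /asboolP.
by apply: bigcup_finite => // j _.
Qed.

Section Broadcast.
Variables (V : finType) (e : rel V) (t r : nat).

Definition signal (u v : V) : nat :=
  if gdist e u v is Some d then (if (d < t)%N then t - d else 0)%N else 0%N.

Definition broadcast (T : {set V}) : bool :=
  [forall u : V, r <= \sum_(v in T) signal u v]%N.

(* The [arg min] needs its default value [setT] to be a broadcast; this is the
   case as soon as [r <= t], see [broadcast_setT] below. *)
Definition broadcast_number : nat :=
  #|[arg min_(T < [set: V]%SET | broadcast T) #|T| ]|.

Lemma broadcast_setT : (r <= t)%N -> broadcast [set: V]%SET.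
Proof.
move=> rt; apply/forallP => u; rewrite (bigD1 u) ?inE //=.
apply: leq_trans (leq_addr _ _); rewrite /signal /gdist.
case: pselect => [h|[]]; last by exists 0%N; apply/asboolP; exists [::].
case: ex_minnP => k _ /(_ 0%N); have -> : `[< walk e u u 0 >].
  by apply/asboolP; exists [::].
move=> /(_ isT); rewrite leqn0 => /eqP ->; rewrite subn0.
by case: t rt => [|?] //; rewrite leqn0 => /eqP ->.
Qed.

End Broadcast.

(** * The truncated square tiling graph *)

Definition vertexH : choiceType := ('Z_4 * (int * int))%type.

Definition arcH (u v : vertexH) : bool :=
  let: (a, (x, y)) := u in
  let: (b, (x', y')) := v in
  [|| [&& b == a + 1, x' == x & y' == y],
      [&& a == 1, b == 3, x' == x + 1 & y' == y] |
      [&& a == 0, b == 2, x' == x & y' == y + 1]].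

Definition edgeH : rel vertexH := fun u v => arcH u v || arcH v u.

(* [fset_set] returns [fset0] on infinite sets; balls of H are finite. *)
Lemma finite_gballH (v : vertexH) (k : nat) : finite_set (gball edgeH v k).
Proof.
apply: finite_gball => -[b [x y]].
pose N : seq vertexH := [seq (a, p) | a <- enum 'Z_4, p <-
  [:: (x, y); (x + 1, y); (x - 1, y); (x, y + 1); (x, y - 1)]].
apply: (@sub_finite_set _ _ [set` N]%classic); last exact: finite_seq.
move=> [a [x' y']] /= ea; apply/allpairsP; exists (a, (x', y')).
split=> //=; first by rewrite mem_enum.
move: ea; rewrite /edgeH /= !inE => /orP[] /or3P[] /and3P[] => [_|_ _|_ _|_|_ _|_ _].
all: try move=> /andP[].
all: by move=> /eqP-> /eqP->; rewrite ?addrK eqxx ?orbT.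
Qed.

(* The eight vertices of O_(x, y) in cyclic order. *)
Definition octagon (x y : int) : seq vertexH :=
  [:: (0, (x, y)); (1, (x, y)); (3, (x + 1, y)); (0, (x + 1, y));
      (2, (x + 1, y + 1)); (3, (x + 1, y + 1)); (1, (x, y + 1));
      (2, (x, y + 1))].

Definition octagon_edge (x y : int) : rel vertexH := fun u v =>
  (u \in octagon x y) && (v == next (octagon x y) u) ||
  (v \in octagon x y) && (u == next (octagon x y) v).

(** The finite subgraph H_(m, n): [m] rows of [n] octagons *)

Definition vertices_Hfin (m n : nat) : seq vertexH :=
  flatten [seq octagon x%:Z y%:Z | x <- iota 0 n, y <- iota 0 m].

Definition Hfin (m n : nat) : finType := seq_sub (vertices_Hfin m n).

Definition edge_Hfin (m n : nat) : rel (Hfin m n) := fun u v =>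
  [exists x : 'I_n, exists y : 'I_m,
     octagon_edge (x : nat)%:Z (y : nat)%:Z (val u) (val v)].
Arguments edge_Hfin : clear implicits.

(* Main.v *)
Require Import Defs.
From HB Require Import structures.
From mathcomp Require Import all_boot all_order all_algebra.
From mathcomp Require Import finmap.
From mathcomp Require Import boolp classical_sets functions cardinality.
From mathcomp Require Import zify.

Import Order.TTheory GRing.Theory Num.Theory.

Local Open Scope ring_scope.

(** A vertex u of H_(m, n) hears a tower w only if u lies within distance
    t - 1 of w in H_(m, n), and then a fortiori in the infinite graph, since
    the inclusion of H_(m, n) sends walks to walks of the same length.  Hence
    the balls of radius t - 1 around the towers, taken in the infinite graph,
    cover the vertices of H_(m, n) ([broadcast_cover]).  The infinite graph is
    vertex-transitive: translations move any cell to any other, and a quarter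
    turn about a cell rotates its 4-cycle.  So all these balls have the same
    number of vertices ([card_gballH]), and that number times the number of
    towers is at least the number of vertices of H_(m, n).  The latter is at
    least 2m + n(4m + 2), as an explicit list of distinct vertices shows
    ([list_verticesH]). *)

Lemma gballP {V : eqType} (e : rel V) (u v : V) (k : nat) :
  gball e v k u <-> exists2 j, walk e u v j & (j <= k)%N.
Proof.
rewrite /gball /= /gdist; case: pselect => [h|noh]; split.
- by move=> [d [<-]] lek; exists (ex_minn h) => //; case: ex_minnP => ? /asboolP.
- move=> [j wj lejk]; exists (ex_minn h) => //; case: ex_minnP => i _ imin.
  by apply: leq_trans lejk; apply/imin/asboolP.
- by case.
- by move=> [j wj _]; case: noh; exists j; apply/asboolP.
Qed.

Lemma gball_center {V : eqType} (e : rel V) (v : V) (k : nat) : gball e v k v.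
Proof. by apply/gballP; exists 0%N => //; exists [::]. Qed.

Lemma gball_homo {V W : eqType} (e : rel V) (e' : rel W) (f : V -> W)
    (v u : V) (k : nat) :
  {homo f : x y / e x y >-> e' x y} ->
  gball e v k u -> gball e' (f v) k (f u).
Proof.
move=> fhom /gballP[j [p [ep lastp sizep]] lejk]; apply/gballP; exists j => //.
by exists (map f p); rewrite last_map lastp size_map; split=> //; apply: homo_path ep.
Qed.

Lemma signal_gt0_gball {V : finType} (e : rel V) (t : nat) (u v : V) :
  (0 < signal e t u v)%N -> gball e v (t - 1)%N u.
Proof.
rewrite /signal /gball /=; case: gdist => [d|] //.
by case: ifP => // ltdt _; exists d => //; lia.
Qed.

(** A sum of natural numbers is positive only if one of its terms is. *)
Lemma broadcast_gball {V : finType} (e : rel V) (t : nat) (T : {set V}) (u : V) :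
  broadcast e t 1 T -> exists2 w, w \in T & gball e w (t - 1)%N u.
Proof.
move=> /forallP/(_ u); rewrite lt0n sum_nat_eq0 negb_forall_in.
by move=> /exists_inP[w wT]; rewrite -lt0n => /signal_gt0_gball; exists w.
Qed.

Lemma broadcast_number_witness {V : finType} (e : rel V) (t r : nat) :
  (r <= t)%N ->
  exists2 T : {set V}, broadcast e t r T & #|T| = broadcast_number e t r.
Proof.
move=> rt; rewrite /broadcast_number.
by case: arg_minnP => [|T bT _]; [exact: broadcast_setT | exists T].
Qed.

Notation ballH v k := (fset_set (gball edgeH v k)).

Lemma mem_ballH (u v : vertexH) (k : nat) : gball edgeH v k u -> u \in ballH v k.
Proof. by move=> uv; rewrite in_fset_set; [apply/mem_set | exact: finite_gballH]. Qed.

Lemma ballHP (u v : vertexH) (k : nat) : u \in ballH v k -> gball edgeH v k u.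
Proof. by rewrite in_fset_set; [move/set_mem | exact: finite_gballH]. Qed.

(** Injective self-homomorphisms suffice here: reachability in both
    directions already compares the cardinalities of balls both ways. *)
Definition embedsH (v w : vertexH) : Prop :=
  exists f : vertexH -> vertexH,
    [/\ injective f, {homo f : x y / edgeH x y} & f v = w].

Lemma embedsH_trans (v w z : vertexH) :
  embedsH v w -> embedsH w z -> embedsH v z.
Proof.
move=> [f [finj fhom <-]] [g [ginj ghom <-]]; exists (g \o f); split=> //.
- exact: inj_comp.
- by move=> x y /fhom/ghom.
Qed.

Lemma edgeH_homo (f : vertexH -> vertexH) :
  {homo f : u v / arcH u v >-> edgeH u v} -> {homo f : u v / edgeH u v}.
Proof.
by move=> fhom u v /orP[/fhom // | /fhom]; rewrite /edgeH orbC.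
Qed.

Lemma embedsH_translation (a : 'Z_4) (p q : int * int) : embedsH (a, p) (a, q).
Proof.
exists (fun u : vertexH =>
  (u.1, (u.2.1 + (q.1 - p.1), u.2.2 + (q.2 - p.2))) : vertexH); split.
- by move=> [b [x y]] [c [x' y']] /= [-> /addIr -> /addIr ->].
- apply: edgeH_homo => -[b [x y]] [c [x' y']] bc; apply/orP; left; move: bc => /=.
  by case/or3P => [/and3P[/eqP-> /eqP-> /eqP->]
    |/and4P[/eqP-> /eqP-> /eqP-> /eqP->]|/and4P[/eqP-> /eqP-> /eqP-> /eqP->]];
    rewrite -?[_ + 1 + _]addrAC !eqxx ?orbT.
- by case: p q => [x y] [x' y'] /=; rewrite !subrKC.
Qed.

(** The quarter turn about the cell (0, 0) takes top to right, hence the cell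
    above to the cell on the right. *)
Lemma embedsH_rotation (a : 'Z_4) : embedsH (a, (0, 0)) (a + 1, (0, 0)).
Proof.
exists (fun u : vertexH => (u.1 + 1, (u.2.2, - u.2.1)) : vertexH); split.
- move=> [b [x y]] [c [x' y']] /pair_equal_spec[/addIr /= -> ].
  by move=> /pair_equal_spec[/= -> /oppr_inj ->].
- apply: edgeH_homo => -[b [x y]] [c [x' y']]; rewrite /edgeH /=.
  case/or3P => [/and3P[/eqP-> /eqP-> /eqP->]
    |/and4P[/eqP-> /eqP-> /eqP-> /eqP->]|/and4P[/eqP-> /eqP-> /eqP-> /eqP->]].
  + by rewrite !eqxx.
  + by rewrite opprD subrK !eqxx !orbT.
  + by rewrite !eqxx !orbT.
- by rewrite /= oppr0.
Qed.

Lemma embedsH_all (v w : vertexH) : embedsH v w.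
Proof.
case: v w => [a p] [b q].
have turns (k : nat) : embedsH (a, (0, 0)) (a + k%:R, (0, 0)).
  elim: k => [|k IHk]; first by rewrite addr0; exact: embedsH_translation.
  by apply: embedsH_trans IHk _; rewrite -natr1 addrA; exact: embedsH_rotation.
apply: embedsH_trans (embedsH_translation a p (0, 0)) _.
apply: embedsH_trans (embedsH_translation b (0, 0) q).
by have := turns (val (b - a)); rewrite natr_Zp addrC subrK.
Qed.

Lemma card_gballH (v w : vertexH) (k : nat) : #|` ballH v k| = #|` ballH w k|.
Proof.
suff le_ball a b : (#|` ballH a k| <= #|` ballH b k|)%N.
  by apply/eqP; rewrite eqn_leq !le_ball.
have [f [finj fhom <-]] := embedsH_all a b.
have <- : #|` (f @` ballH a k)%fset| = #|` ballH a k| by exact: card_imfset.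
apply/fsubset_leq_card/fsubsetP => _ /imfsetP[u /= ua ->].
by apply/mem_ballH/gball_homo/ballHP.
Qed.

Lemma octagon_cycle (x y : int) : cycle edgeH (octagon x y).
Proof. by rewrite /= /edgeH /= !eqxx. Qed.

Lemma edge_Hfin_edgeH (m n : nat) :
  {homo (val : Hfin m n -> vertexH) : u v / edge_Hfin m n u v >-> edgeH u v}.
Proof.
move=> u v /existsP[x /existsP[y /orP[]/andP[inO /eqP->]]].
  exact: next_cycle (octagon_cycle _ _) inO.
by rewrite /edgeH orbC; exact: next_cycle (octagon_cycle _ _) inO.
Qed.

Lemma mem_vertices_Hfin (m n x y : nat) (u : vertexH) :
  (x < n)%N -> (y < m)%N -> u \in octagon x%:Z y%:Z -> u \in vertices_Hfin m n.
Proof.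
move=> ltxn ltym uO; apply/flattenP; exists (octagon x%:Z y%:Z) => //.
by apply/allpairsP; exists (x, y); rewrite !mem_iota.
Qed.

(** The octagons of H_(m, n) meet the 4-cycles of an (n + 1) x (m + 1) grid,
    but miss their outward vertices along the border: the bottom vertices of
    the lowest row, the left vertices of the leftmost column, the top vertices
    of the highest row and the right vertices of the rightmost column.  The
    booleans in the ranges remove these four lines. *)
Definition list_verticesH (m n : nat) : seq vertexH :=
  [seq (a, p) | a : 'Z_4 <- [:: 0; 1; 2; 3],
    p <- [seq (x%:Z, y%:Z) | x <- iota (a == 3) (n + ~~ odd a),
                             y <- iota (a == 2) (m + odd a)]].

Lemma uniq_list_verticesH (m n : nat) : uniq (list_verticesH m n).
Proof.
apply: allpairs_uniq_dep => // [a _|[a p] [b q] _ _ /= [-> ->] //].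
by apply: allpairs_uniq; rewrite ?iota_uniq // => -[x y] [x' y'] _ _ /= [-> ->].
Qed.

Lemma size_list_verticesH (m n : nat) :
  size (list_verticesH m n) = (2 * m + n * (4 * m + 2))%N.
Proof. by rewrite size_allpairs_dep /= !size_allpairs !size_iota /=; lia. Qed.

Lemma sub_list_verticesH (m n : nat) : (1 <= m)%N -> (1 <= n)%N ->
  {subset list_verticesH m n <= vertices_Hfin m n}.
Proof.
move=> hm hn _ /allpairsPdep[a [_ [a4 /allpairsP[[x y] [/= xa ya ->]] ->]]].
have shift (z : nat) : (0 < z)%N -> z%:Z = z.-1%:Z + 1 by lia.
(* A top or bottom vertex of column x lies on the left side of an octagon of
   column x and on the right side of one of column x - 1; the latter serves in
   the last column.  Likewise for right and left vertices, with rows. *)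
move: xa ya a4; rewrite !mem_iota !inE => xa ya /or4P[] /eqP Ea; subst a;
  rewrite /= in xa ya.
- case: (ltnP x n) => xn.
    by apply: (@mem_vertices_Hfin _ _ x y); rewrite ?inE ?eqxx //; lia.
  apply: (@mem_vertices_Hfin _ _ x.-1 y); [lia|lia|].
  by rewrite (shift x) ?inE ?eqxx ?orbT //; lia.
- case: (ltnP y m) => ym.
    by apply: (@mem_vertices_Hfin _ _ x y); rewrite ?inE ?eqxx ?orbT //; lia.
  apply: (@mem_vertices_Hfin _ _ x y.-1); [lia|lia|].
  by rewrite (shift y) ?inE ?eqxx ?orbT //; lia.
- case: (ltnP x n) => xn.
    apply: (@mem_vertices_Hfin _ _ x y.-1); [lia|lia|].
    by rewrite (shift y) ?inE ?eqxx ?orbT //; lia.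
  apply: (@mem_vertices_Hfin _ _ x.-1 y.-1); [lia|lia|].
  by rewrite (shift x) ?(shift y) ?inE ?eqxx ?orbT //; lia.
- case: (ltnP y m) => ym.
    apply: (@mem_vertices_Hfin _ _ x.-1 y); [lia|lia|].
    by rewrite (shift x) ?inE ?eqxx ?orbT //; lia.
  apply: (@mem_vertices_Hfin _ _ x.-1 y.-1); [lia|lia|].
  by rewrite (shift x) ?(shift y) ?inE ?eqxx ?orbT //; lia.
Qed.

Lemma broadcast_cover (m n t : nat) (T : {set Hfin m n}) (u : vertexH) :
  broadcast (edge_Hfin m n) t 1 T -> u \in vertices_Hfin m n ->
  exists2 w, w \in T & u \in ballH (val w) (t - 1)%N.
Proof.
move=> bT uH; have [w wT uw] := broadcast_gball _ _ _ (SeqSub uH) bT.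
exists w => //; apply: mem_ballH.
exact: (gball_homo _ _ val _ _ _ (edge_Hfin_edgeH m n)) uw.
Qed.

Lemma leq_card_broadcast (m n t : nat) (v : vertexH) (T : {set Hfin m n}) :
  (1 <= m)%N -> (1 <= n)%N -> broadcast (edge_Hfin m n) t 1 T ->
  (2 * m + n * (4 * m + 2) <= #|T| * #|` ballH v (t - 1)%N|)%N.
Proof.
move=> hm hn bT; rewrite -size_list_verticesH.
pose cover := [seq u | w <- enum T, u <- ballH (val w) (t - 1)%N].
have -> : (#|T| * #|` ballH v (t - 1)%N|)%N = size cover.
  rewrite size_allpairs_dep sumnE big_map big_enum /= -sum_nat_const.
  by apply: eq_bigr => w _; exact: card_gballH.
apply: uniq_leq_size (uniq_list_verticesH m n) _ => u uL.
have [w wT uw] := broadcast_cover _ _ _ _ _ bT (sub_list_verticesH _ _ hm hn _ uL).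
by apply/allpairsPdep; exists w, u; rewrite mem_enum.
Qed.

Theorem theorem3p3 (m n t : nat) (v : vertexH)
    (hm : (1 <= m)%N) (hn : (1 <= n)%N) (ht : (2 <= t)%N) :
  Num.ceil ((2 * m + n * (4 * m + 2))%N%:R
            / #|` fset_set (gball edgeH v (t - 1)%N)|%:R : rat)
    <= (broadcast_number (edge_Hfin m n) t 1)%:Z.
Proof.
have [T bT <-] := broadcast_number_witness (edge_Hfin m n) t 1 (ltnW ht).
have ball_gt0 : (0 < #|` ballH v (t - 1)%N|)%N.
  rewrite cardfs_gt0; apply/fset0Pn; exists v.
  exact/mem_ballH/gball_center.
rewrite ceil_le_int ler_pdivrMr ?ltr0n // -natrM ler_nat.
exact: leq_card_broadcast.
Qed.
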